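(* Let $n>2$ be an integer and let $\mathbb{F}$ be a field with $|\mathbb{F}|\geq 4$. Then every matrix in $SL_n(\mathbb{F})$ is a product of at most four commutators of $\mathcal{U}_2$-matrices.
   Context: $M_n(\mathbb{F})$ is the set of $n\times n$ matrices over the field $\mathbb{F}$ (finite or infinite; infinite fields satisfy any lower bound on $|\mathbb F|$), and $SL_n(\mathbb{F})$ is the group of $n\times n$ matrices over $\mathbb F$ with determinant $1$. A matrix $X\in M_n(\mathbb{F})$ is a $\mathcal{U}_2$-matrix (unipotent matrix of index $2$) if $(X-I_n)^2=0_n$ and $X\neq I_n$. For invertible $X,Y$, $[X,Y]:=XYX^{-1}Y^{-1}$. A commutator of $\mathcal{U}_2$-matrices (in $M_n(\mathbb F)$) is a matrix of the form $[X,Y]$ where both $X,Y\in M_n(\mathbb{F})$ are $\mathcal{U}_2$-matrices. *)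

(* Defs.v *)
From mathcomp Require Import all_boot all_order all_algebra.

Set Implicit Arguments.
Unset Strict Implicit.
Unset Printing Implicit Defensive.

Import GRing.Theory.
Local Open Scope ring_scope.

(* The carrier of a fieldType need not be a finType, so #|F| is not available. *)
Definition card_geq (T : eqType) (k : nat) : Prop :=
  exists s : seq T, uniq s /\ size s = k.

Definition U2_matrix (F : fieldType) (n : nat) (X : 'M[F]_n) : Prop :=
  (X - 1%:M) *m (X - 1%:M) = 0 /\ X <> 1%:M.

(* invmx X is X itself when X is singular; every U2_matrix is invertible, with
   inverse 2%:M - X, so this default is not reached in U2_commutator. *)
Definition commutator_mx (F : fieldType) (n : nat) (X Y : 'M[F]_n) : 'M[F]_n :=
  X *m Y *m invmx X *m invmx Y.

Definition U2_commutator (F : fieldType) (n : nat) (A : 'M[F]_n) : Prop :=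
  exists X Y : 'M[F]_n,
    [/\ U2_matrix X, U2_matrix Y & A = commutator_mx X Y].

(* Main.v *)
Require Import Defs.
From mathcomp Require Import all_boot all_order all_algebra.
From mathcomp Require Import ring zify.
Set Implicit Arguments.
Unset Strict Implicit.
Unset Printing Implicit Defensive.
Import GRing.Theory.
Local Open Scope ring_scope.

(** A nonscalar matrix of determinant 1 is similar to [L U] with [L] lower and
    [U] upper unitriangular, and every unipotent matrix is a product of two
    commutators: by the Jordan form it is enough to treat a single block of
    size k.  For k <> 2 the block is, up to similarity, a product of two direct
    sums of small blocks filling complementary parts of the superdiagonal, and
    such a sum is a commutator in sizes 3, 4, 5 up to identity blocks.  For
    k = 2, the noncentral matrices of SL_2 of trace 2 + t^2, with t <> 0, are
    commutators, and the block is a product of two of these as soon as the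
    field has two distinct nonzero squares.

    A scalar x of order d is a direct sum of copies of size d.  If d >= 3, then
    the powers of x provide enough distinct squares to build a single
    commutator C, a direct sum of 2 x 2 blocks of distinct traces 2 + r^2, for
    which B = x C^-1 is cyclic.  A cyclic matrix of determinant 1 is similar to
    a transvection times a unipotent Jordan block, hence it is a product of
    1 + 2 commutators, and x = B C of four.  If d = 2, then x = -1 is the square
    of a product of two noncentral matrices of SL_2 of trace 6 = 2 + 2^2. *)

(** * Similarity, and products of commutators of unipotent matrices of index at most 2 *)

(* Letting the two sizes differ avoids casts along equalities of sizes. *)
Definition mxsim (F : fieldType) m n (A : 'M[F]_m) (B : 'M[F]_n) : Prop :=
  exists P : 'M[F]_(m, n), exists Q : 'M[F]_(n, m),
    [/\ P *m Q = 1%:M, Q *m P = 1%:M & A *m P = P *m B].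

Lemma mxsim_sym (F : fieldType) m n (A : 'M[F]_m) (B : 'M[F]_n) :
  mxsim A B -> mxsim B A.
Proof.
move=> [P [Q [PQ QP APB]]]; exists Q, P; split=> //.
by rewrite -[B *m Q]mul1mx -QP -mulmxA (mulmxA P) -APB -!mulmxA PQ mulmx1.
Qed.

Lemma mxsim_trans (F : fieldType) m n p
    (A : 'M[F]_m) (B : 'M[F]_n) (C : 'M[F]_p) :
  mxsim A B -> mxsim B C -> mxsim A C.
Proof.
move=> [P [Q [PQ QP AP]]] [P' [Q' [PQ' QP' BP']]].
exists (P *m P'), (Q' *m Q); split.
- by rewrite mulmxA -(mulmxA P) PQ' mulmx1.
- by rewrite mulmxA -(mulmxA Q') QP mulmx1.
- by rewrite mulmxA AP -mulmxA BP' mulmxA.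
Qed.

Lemma mxsim_unit (F : fieldType) n (A B P : 'M[F]_n) :
  P \in unitmx -> P *m A = B *m P -> mxsim A B.
Proof.
move=> uP PA; apply: mxsim_sym; exists P, (invmx P).
by split; rewrite ?mulmxV ?mulVmx.
Qed.

(* [A] is the commutator of [X] and [Y], which may be the identity. *)
Definition unip2_comm (F : fieldType) n (A : 'M[F]_n) : Prop :=
  exists X Y : 'M[F]_n, [/\ (X - 1%:M) *m (X - 1%:M) = 0,
    (Y - 1%:M) *m (Y - 1%:M) = 0 & X *m Y = A *m Y *m X].

Lemma sqr_sub1_conj (F : fieldType) m n (P : 'M[F]_(m, n)) (Q : 'M[F]_(n, m))
    (X : 'M[F]_m) : P *m Q = 1%:M -> Q *m P = 1%:M ->
  (X - 1%:M) *m (X - 1%:M) = 0 ->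
  (Q *m X *m P - 1%:M) *m (Q *m X *m P - 1%:M) = 0.
Proof.
move=> PQ QP X2.
have -> : Q *m X *m P - 1%:M = Q *m (X - 1%:M) *m P.
  by rewrite mulmxBr mulmxBl mulmx1 QP.
by rewrite -!mulmxA (mulmxA P) PQ mul1mx (mulmxA (X - _)) X2 mul0mx mulmx0.
Qed.

Lemma unip2_comm_sim (F : fieldType) m n (A : 'M[F]_m) (B : 'M[F]_n) :
  mxsim A B -> unip2_comm A -> unip2_comm B.
Proof.
move=> [P [Q [PQ QP APB]]] [X [Y [X2 Y2 XY]]].
exists (Q *m X *m P), (Q *m Y *m P); split; rewrite ?sqr_sub1_conj //.
have -> : Q *m X *m P *m (Q *m Y *m P) = Q *m (X *m Y) *m P.
  by rewrite -!mulmxA (mulmxA P Q) PQ mul1mx.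
have -> : B = Q *m A *m P by rewrite -mulmxA APB mulmxA QP mul1mx.
by rewrite XY -!mulmxA !(mulmxA P Q) PQ !mul1mx.
Qed.

Lemma unip2_comm1 (F : fieldType) n : unip2_comm (1%:M : 'M[F]_n).
Proof. by exists 1%:M, 1%:M; rewrite !subrr !mulmx0 !mulmx1. Qed.

Lemma unip2_comm_block (F : fieldType) m n (A : 'M[F]_m) (B : 'M[F]_n) :
  unip2_comm A -> unip2_comm B -> unip2_comm (block_mx A 0 0 B).
Proof.
move=> [X [Y [X2 Y2 XY]]] [X' [Y' [X2' Y2' XY']]].
exists (block_mx X 0 0 X'), (block_mx Y 0 0 Y').
rewrite !(scalar_mx_block, opp_block_mx, add_block_mx, mulmx_block).
rewrite !(oppr0, mulmx0, mul0mx, addr0, add0r) X2 X2' Y2 Y2' XY XY'.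
by rewrite -[0 in RHS]block_mx0.
Qed.

(** Since the identity is itself an admissible factor, exactly [k] factors amounts to at most
    [k]. *)
Fixpoint prod_comm (F : fieldType) (k : nat) n (A : 'M[F]_n) : Prop :=
  if k is k'.+1 then
    exists B C : 'M[F]_n, [/\ unip2_comm B, prod_comm k' C & A = B *m C]
  else A = 1%:M.

Lemma prod_comm1 (F : fieldType) k n : prod_comm k (1%:M : 'M[F]_n).
Proof.
elim: k => //= k IHk; exists 1%:M, 1%:M.
by split; rewrite ?mulmx1 //; apply: unip2_comm1.
Qed.

Lemma prod_commM (F : fieldType) k l n (A B : 'M[F]_n) :
  prod_comm k A -> prod_comm l B -> prod_comm (k + l) (A *m B).
Proof.
elim: k A => /= [|k IHk] A; first by move=> ->; rewrite mul1mx.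
move=> [C [D [cC kD ->]]] lB; exists C, (D *m B); rewrite mulmxA.
by split=> //; apply: IHk.
Qed.

Lemma prod_comm_of_comm (F : fieldType) n (A : 'M[F]_n) :
  unip2_comm A -> prod_comm 1 A.
Proof. by move=> cA; exists A, 1%:M; rewrite mulmx1. Qed.

Lemma prod_comm_sim (F : fieldType) k m n (A : 'M[F]_m) (B : 'M[F]_n) :
  mxsim A B -> prod_comm k A -> prod_comm k B.
Proof.
move=> [P [Q [PQ QP APB]]].
have -> : B = Q *m A *m P by rewrite -mulmxA APB mulmxA QP mul1mx.
elim: k A {APB} => [|k IHk] A /=; first by move=> ->; rewrite mulmx1.
move=> [C [D [cC kD ->]]]; exists (Q *m C *m P), (Q *m D *m P); split.
- apply: unip2_comm_sim cC; exists P, Q; split=> //.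
  by rewrite !mulmxA PQ mul1mx.
- exact: IHk.
- by rewrite -!mulmxA (mulmxA P Q) PQ mul1mx.
Qed.

Lemma prod_comm_block (F : fieldType) k m n (A : 'M[F]_m) (B : 'M[F]_n) :
  prod_comm k A -> prod_comm k B -> prod_comm k (block_mx A 0 0 B).
Proof.
elim: k A B => [|k IHk] A B /=.
  by move=> -> ->; rewrite -scalar_mx_block.
move=> [C [D [cC kD ->]]] [C' [D' [cC' kD' ->]]].
exists (block_mx C 0 0 C'), (block_mx D 0 0 D'); split.
- exact: unip2_comm_block.
- exact: IHk.
- by rewrite mulmx_block !(mulmx0, mul0mx, addr0, add0r).
Qed.

Lemma unitmx_sqr_sub1 (F : fieldType) n (X : 'M[F]_n) :
  (X - 1%:M) *m (X - 1%:M) = 0 -> X \in unitmx.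
Proof.
move=> X2; suff /mulmx1_unit[] : X *m (2%:R *: 1%:M - X) = 1%:M by [].
move: X2; rewrite mulmxBl !mulmxBr !mulmx1 mul1mx -scalemxAr mulmx1.
move=> /eqP; rewrite subr_eq0 subr_eq => /eqP ->.
by rewrite scaler_nat mulr2n; apply/matrixP=> i j; rewrite !mxE; ring.
Qed.

(** If one of [X], [Y] is the identity, then so is [A], and 1 is the commutator of a transvection
    with itself; a transvection exists because the size is at least 2. *)
Lemma U2_commutator_of_unip2 (F : fieldType) n (A : 'M[F]_n) :
  (1 < n)%N -> unip2_comm A -> U2_commutator A.
Proof.
case: n A => [|[|n]] // A _ [X [Y [X2 Y2 XY]]].
have uX := unitmx_sqr_sub1 X2; have uY := unitmx_sqr_sub1 Y2.
have AE : A = commutator_mx X Y by rewrite /commutator_mx XY !mulmxK.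
suff trivial_case : A = 1%:M -> U2_commutator A.
  have [X1|/eqP X1] := eqVneq X 1%:M.
    apply: trivial_case.
    by rewrite AE /commutator_mx X1 invmx1 mulmx1 mul1mx mulmxV.
  have [Y1|/eqP Y1] := eqVneq Y 1%:M; last by exists X, Y.
  by apply: trivial_case; rewrite AE /commutator_mx Y1 invmx1 !mulmx1 mulmxV.
move=> ->; pose Z : 'M[F]_n.+2 := 1%:M + delta_mx 0 1.
have ZE : Z - 1%:M = delta_mx 0 1 by rewrite /Z addrC addKr.
have Z2 : (Z - 1%:M) *m (Z - 1%:M) = 0 by rewrite ZE mul_delta_mx_0.
have UZ : U2_matrix Z.
  split=> // /eqP; rewrite -subr_eq0 ZE => /eqP/matrixP/(_ 0 1)/eqP.
  by rewrite !mxE !eqxx oner_eq0.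
exists Z, Z; split=> //.
by rewrite /commutator_mx mulmxK ?mulmxV ?(unitmx_sqr_sub1 Z2).
Qed.

(** * Nonscalar matrices of determinant 1 as products of two unipotent matrices *)

(** It is enough to test the vectors e_i and e_i + e_j: if every e_i is an eigenvector, then [A] is
    diagonal, and e_0 + e_i then forces its diagonal entries to agree. *)
Lemma nonscalar_noneigen (F : fieldType) n (A : 'M[F]_n) :
  ~~ is_scalar_mx A -> exists v : 'rV_n, ~~ (v *m A <= v)%MS.
Proof.
pose w (ij : 'I_n * 'I_n) : 'rV[F]_n :=
  delta_mx 0 ij.1 + (ij.1 != ij.2)%:R *: delta_mx 0 ij.2.
move=> nsA; case: (pickP (fun ij => ~~ (w ij *m A <= w ij)%MS)) => [ij|eigA].
  by exists (w ij).
case/negP: nsA; case: n A @w eigA => [|n] A w eigA.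
  by rewrite [A]flatmx0 mx0_is_scalar.
have eig i j : exists a, forall k,
    A i k + (i != j)%:R * A j k = a * ((k == i)%:R + (i != j)%:R * (k == j)%:R).
  have /negbFE/sub_rVP[a wA] := eigA (i, j); exists a => k.
  move/rowP/(_ k): wA; rewrite /w /= mulmxDl -scalemxAl -!rowE !mxE !eqxx /=.
  done.
have diagA i k : k != i -> A i k = 0.
  have [a /(_ k)] := eig i i; rewrite eqxx !mul0r !addr0 => -> /negPf->.
  by rewrite mulr0.
apply/is_scalar_mxP; exists (A 0 0); apply/matrixP=> i k; rewrite mxE.
have [<-|nik] := eqVneq i k; last by apply: diagA; rewrite eq_sym.
have [->//|ni0] := eqVneq i 0.
have [a aE] := eig i 0; move: (aE i) (aE 0).
rewrite ni0 !mul1r eqxx (eq_sym 0) (negPf ni0) !addr0 !mulr1 !add0r.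
by rewrite (diagA 0) // (diagA i 0) 1?eq_sym // addr0 add0r mulr1 => -> ->.
Qed.

(** In a basis whose first vector is proportional to a noneigenvector [v], the vanishing of [r]
    would make [v] an eigenvector. *)
Lemma nonscalar_sim_offdiag (F : fieldType) n (A : 'M[F]_(1 + n)) :
  ~~ is_scalar_mx A ->
  exists a (r : 'rV_n) (c : 'cV_n) D, r != 0 /\ mxsim A (block_mx a r c D).
Proof.
move=> /nonscalar_noneigen[v nvA].
pose P := row_ebase v; have uP : P \in unitmx by apply: row_ebase_unit.
have v0 : v != 0 by apply: contraNneq nvA => ->; rewrite mul0mx.
(* As [v] has rank one, its rank factorisation retains only the first row of [row_ebase v]. *)
have [x vE] : exists x, v = x *: row 0 P.
  exists (col_ebase v 0 0).
  rewrite -[LHS]mulmx_ebase rank_rV v0 -/P [col_ebase v]mx11_scalar.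
  rewrite !mul_scalar_mx -scalemxAl !mxE /=; congr (_ *: _).
  rewrite rowE; congr (_ *m P); apply/rowP=> j; rewrite !mxE /=.
  by rewrite andbT eq_sym.
pose B : 'M_(1 + n) := P *m A *m invmx P.
exists (ulsubmx B), (ursubmx B), (dlsubmx B), (drsubmx B); split; last first.
  by rewrite submxK; apply: (mxsim_unit uP); rewrite /B mulmxKV.
apply: contraNneq nvA => r0.
rewrite vE -scalemxAl -row_mul -[P *m A](mulmxKV uP) -/B row_mul.
have -> : row 0 B = B 0 0 *: delta_mx 0 0.
  apply/rowP=> j; rewrite !mxE /=.
  case: (splitP (j : 'I_(1 + n))) => k jk.
    have -> : j = 0 by apply/val_inj; rewrite /= jk ord1.
    by rewrite mulr1.
  move/rowP/(_ k): r0; rewrite !mxE /= => E.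
  have -> : j = rshift 1 k by apply/val_inj.
  have -> : (0 : 'I_(1 + n)) = lshift n 0 by apply/val_inj.
  by rewrite E eqE /= mulr0.
by rewrite -scalemxAl -rowE scalerA mulrC -scalerA scalemx_sub.
Qed.

(** The free column [q] serves twice: to turn the corner into the pivot 1, and, when [r *m q]
    vanishes, to change the Schur complement while keeping that pivot. *)
Lemma mxsim_lower_conj (F : fieldType) n (q : 'cV[F]_n) (a : 'M[F]_1) r c D :
  mxsim (block_mx a r c D)
    (block_mx (a - r *m q) r (q *m a + c - (q *m r + D) *m q) (q *m r + D)).
Proof.
apply: (@mxsim_unit _ _ _ _ (block_mx 1%:M 0 q 1%:M)).
  by rewrite unitmxE det_lblock !det1 mulr1 unitr1.
rewrite !mulmx_block !(mulmx0, mulmx1, mul0mx, mul1mx, addr0, add0r).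
by rewrite !subrK.
Qed.

Definition nilp (F : fieldType) n (N : 'M[F]_n) : Prop := exists k, N ^+ k = 0.

Lemma nilp_ublock (F : fieldType) m n (r : 'M[F]_(m, n)) (N : 'M[F]_n) :
  nilp N -> nilp (block_mx 0 r 0 N).
Proof.
move=> [k Nk]; exists k.+1.
have -> : block_mx 0 r 0 N ^+ k.+1 = block_mx 0 (r *m N ^+ k) 0 (N ^+ k.+1).
  elim: k {Nk} => [|k IHk]; first by rewrite !expr1 expr0 mulmx1.
  rewrite exprSr IHk -[LHS]/(_ *m _) mulmx_block.
  rewrite !(mulmx0, mul0mx, addr0, add0r) -mulmxA.
  by rewrite -[N ^+ k *m N]/(N ^+ k * N) -[N ^+ _ *m N]/(N ^+ k.+1 * N) -!exprSr.
by rewrite exprS Nk mulr0 mulmx0 block_mx0.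
Qed.

Lemma nilp_lblock (F : fieldType) m n (c : 'M[F]_(n, m)) (N : 'M[F]_n) :
  nilp N -> nilp (block_mx 0 0 c N).
Proof.
move=> [k Nk]; exists k.+1.
have -> : block_mx 0 0 c N ^+ k.+1 = block_mx 0 0 (N ^+ k *m c) (N ^+ k.+1).
  elim: k {Nk} => [|k IHk]; first by rewrite !expr1 expr0 mul1mx.
  rewrite exprS IHk -[LHS]/(_ *m _) mulmx_block.
  rewrite !(mulmx0, mul0mx, addr0, add0r) mulmxA.
  by rewrite -[N *m N ^+ k]/(N * N ^+ k) -[N *m N ^+ _]/(N * N ^+ k.+1) -!exprS.
by rewrite exprS Nk mulr0 mul0mx block_mx0.
Qed.

(** Only unipotence of the factors is recorded: unlike triangularity, it survives a change of
    basis. *)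
Definition unip_prod (F : fieldType) n (A : 'M[F]_n) : Prop :=
  exists B C : 'M[F]_n, [/\ nilp (B - 1%:M), nilp (C - 1%:M) & A = B *m C].

Lemma unip_prod_sim (F : fieldType) n (A B : 'M[F]_n) :
  mxsim A B -> unip_prod A -> unip_prod B.
Proof.
move=> [P [Q [PQ QP APB]]] [C [D [nC nD AE]]].
have conj_nilp M : nilp (M - 1%:M) -> nilp (Q *m M *m P - 1%:M).
  move=> [k Mk]; exists k.
  have -> : Q *m M *m P - 1%:M = Q *m (M - 1%:M) *m P.
    by rewrite mulmxBr mulmxBl mulmx1 QP.
  have -> : (Q *m (M - 1%:M) *m P) ^+ k = Q *m (M - 1%:M) ^+ k *m P.
    elim: k {Mk} => [|k IHk]; first by rewrite !expr0 mulmx1 QP.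
    rewrite !exprS IHk -[LHS]/(_ *m _) -[in RHS]/(_ *m _).
    by rewrite -!mulmxA (mulmxA P) PQ mul1mx.
  by rewrite Mk mulmx0 mul0mx.
exists (Q *m C *m P), (Q *m D *m P); split; [exact: conj_nilp..|].
rewrite -!mulmxA (mulmxA P) PQ mul1mx (mulmxA C) -AE.
by rewrite APB mulmxA QP mul1mx.
Qed.

(* One step of an LU factorisation: the pivot is 1 and the Schur complement
   is [D - c *m r]. *)
Lemma unip_prod_schur (F : fieldType) n r c (D : 'M[F]_n) :
  unip_prod (D - c *m r) -> unip_prod (block_mx (1%:M : 'M_1) r c D).
Proof.
move=> [B [C [nB nC DE]]].
exists (block_mx 1%:M 0 c B), (block_mx 1%:M r 0 C); split.
- rewrite (@scalar_mx_block _ 1 n) opp_block_mx add_block_mx.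
  by rewrite !subrr !subr0; apply: nilp_lblock.
- rewrite (@scalar_mx_block _ 1 n) opp_block_mx add_block_mx.
  by rewrite !subrr !subr0; apply: nilp_ublock.
- rewrite mulmx_block !(mulmx0, mulmx1, mul0mx, mul1mx, addr0, add0r) -DE.
  by rewrite addrC subrK.
Qed.

Lemma rV_orthogonal (F : fieldType) n (r : 'rV[F]_n) :
  (1 < n)%N -> exists2 q : 'cV_n, q != 0 & r *m q = 0.
Proof.
move=> n1; have : (0 < \rank (kermx r^T))%N.
  rewrite mxrank_ker subn_gt0; apply: leq_ltn_trans n1.
  exact: rank_leq_col.
rewrite lt0n mxrank_eq0 => /rowV0Pn[v /sub_kermxP vr v0].
exists v^T; first by rewrite trmx_eq0.
by apply: trmx_inj; rewrite trmx_mul trmxK trmx0.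
Qed.

Lemma rV_solve (F : fieldType) n (r : 'rV[F]_n) (b : 'M[F]_1) :
  r != 0 -> exists q : 'cV_n, r *m q = b.
Proof.
move=> r0; exists (pinvmx r *m b).
by rewrite mulmxA mulmxVp ?mul1mx // /row_free rank_rV r0.
Qed.

Lemma det_mxsim (F : fieldType) n (A B : 'M[F]_n) :
  mxsim A B -> \det A = \det B.
Proof.
move=> [P [Q [PQ QP AP]]].
have uP : \det P * \det Q = 1 by rewrite -det_mulmx PQ det1.
by rewrite -[A]mulmx1 -PQ mulmxA AP !det_mulmx mulrAC uP mul1r.
Qed.

Lemma det_schur (F : fieldType) n (A : 'M[F]_(1 + n)) r c (D : 'M[F]_n) :
  mxsim A (block_mx (1%:M : 'M_1) r c D) -> \det (D - c *m r) = \det A.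
Proof.
move=> /det_mxsim ->.
have -> : block_mx (1%:M : 'M_1) r c D =
    block_mx 1%:M 0 c 1%:M *m block_mx 1%:M r 0 (D - c *m r).
  rewrite mulmx_block !(mulmx0, mulmx1, mul0mx, mul1mx, addr0, add0r).
  by rewrite addrC subrK.
by rewrite det_mulmx det_lblock det_ublock !det1 !mul1r.
Qed.

(** Induction through the Schur complement: [r != 0] allows a [q] for which the pivot is 1, and the
    complement then has determinant 1. A scalar complement of size at most 1 is the identity; a
    larger one is made nonscalar by a second conjugation. *)
Lemma nonscalar_unip_prod (F : fieldType) n (A : 'M[F]_n) :
  ~~ is_scalar_mx A -> \det A = 1 -> unip_prod A.
Proof.
elim: n A => [|n IHn] A; first by rewrite [A]flatmx0 mx0_is_scalar.
rewrite -[n.+1]/(1 + n)%N in A * => nsA detA.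
have [a [r [c [D [r0 simA]]]]] := nonscalar_sim_offdiag nsA.
have [q rq] := rV_solve (a - 1%:M) r0.
have {simA} := mxsim_trans simA (mxsim_lower_conj q a r c D).
rewrite {}rq subKr; move: (q *m r + D) (q *m a + c - _) => {}D {a}c simA.
have detD := det_schur simA; rewrite detA in detD.
have [nsD|sD] := boolP (~~ is_scalar_mx (D - c *m r)).
  exact: unip_prod_sim (mxsim_sym simA) (unip_prod_schur (IHn _ nsD detD)).
move: sD; rewrite negbK => /is_scalar_mxP[m mE].
have [n1|n1] := leqP n 1.
  apply: unip_prod_sim (mxsim_sym simA) (unip_prod_schur _).
  suff -> : D - c *m r = 1%:M.
    exists 1%:M, 1%:M; rewrite mulmx1 subrr.
    by split=> //; exists 1%N; rewrite expr1.
  rewrite mE; move: detD; rewrite mE det_scalar.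
  case: (n) n1 => [|[|//]] _ //; last by rewrite expr1 => ->.
  by move=> _; rewrite [LHS]flatmx0 [RHS]flatmx0.
(* The Schur complement becomes the scalar m plus the rank one square zero
   matrix m q r. *)
have [{}q q0 rq] := rV_orthogonal r n1.
have {simA} := mxsim_trans simA (mxsim_lower_conj q 1%:M r c D).
rewrite rq subr0 mulmx1.
set c' := _ - _; set D' := _ + _; move=> simA.
have D'E : D' - c' *m r = m%:M + m *: (q *m r).
  have DE : D = m%:M + c *m r by rewrite -mE subrK.
  rewrite /D' /c' mulmxDl -(mulmxA q r q) rq mulmx0 add0r.
  rewrite DE !mulmxDl -(mulmxA c) rq mulmx0 addr0 mul_scalar_mx mulNmx -scalemxAl.
  by apply/matrixP=> i j; rewrite !mxE; ring.
have m0 : m != 0.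
  apply: contra_eqN detD => /eqP m0; rewrite mE m0 det_scalar expr0n.
  by rewrite gtn_eqF ?(ltn_trans _ n1) // eq_sym oner_eq0.
apply: unip_prod_sim (mxsim_sym simA) (unip_prod_schur (IHn _ _ _)); rewrite D'E.
- apply/is_scalar_mxP=> -[b E].
  (* Applying both sides to [q], which [r] kills, identifies the scalar; then [q *m r] would be
     0. *)
  have bm : b = m.
    move/(congr1 (mulmx^~ q)): E; rewrite mulmxDl -scalemxAl -(mulmxA q) rq.
    rewrite mulmx0 scaler0 addr0 !mul_scalar_mx => /eqP.
    rewrite eq_sym -subr_eq0 -scalerBl scaler_eq0 (negPf q0) orbF subr_eq0.
    by move/eqP.
  have /eqP : m *: (q *m r) = 0 by apply: (addrI m%:M); rewrite addr0 E bm.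
  rewrite scaler_eq0 (negPf m0) /= mulmx_free_eq0 ?(negPf q0) //.
  by rewrite /row_free rank_rV r0.
- by rewrite -D'E (det_schur simA).
Qed.

(** * Jordan form of nilpotent matrices *)

Definition shift_mx (F : fieldType) n : 'M[F]_n :=
  \matrix_(i, j) (j == i.+1 :> nat)%:R.

(** Indexing the rows of [B] by naturals makes the product an index shift; the condition on [f m]
    accounts for the zero last row. *)
Lemma mul_shift_mx (F : fieldType) m n (f : nat -> 'I_n -> F) (B : 'M[F]_(m, n)) :
  (forall i j, B i j = f i j) -> (forall j, f m j = 0) ->
  shift_mx F m *m B = \matrix_(i, j) f i.+1 j.
Proof.
move=> fE f0; apply/matrixP=> i j; rewrite !mxE.
have [im|im] := ltnP i.+1 m.
  rewrite (bigD1 (Ordinal im)) //= mxE eqxx mul1r fE big1 ?addr0 // => k ki.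
  by rewrite mxE -[i.+1]/(val (Ordinal im)) (inj_eq val_inj) (negPf ki) mul0r.
rewrite big1 => [|k _].
  by rewrite (_ : i.+1 = m) ?f0 //; apply/eqP; rewrite eqn_leq im ltn_ord.
by rewrite mxE ltn_eqF ?mul0r // (leq_trans (ltn_ord k)).
Qed.

Lemma mulmx_shift (F : fieldType) m n (f : 'I_n -> nat -> F) (B : 'M[F]_(n, m)) :
  (forall i j, B i j = f i j.+1) -> (forall i, f i 0%N = 0) ->
  B *m shift_mx F m = \matrix_(i, j) f i j.
Proof.
move=> fE f0; apply/matrixP=> i j; rewrite !mxE.
case: j => [[|j] jm] /=.
  by rewrite f0 big1 // => k _; rewrite mxE mulr0.
rewrite (bigD1 (Ordinal (ltnW jm))) //= mxE eqxx mulr1 fE big1 ?addr0 // => k kj.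
rewrite mxE /= eqSS eq_sym.
by rewrite -[j]/(val (Ordinal (ltnW jm))) (inj_eq val_inj) (negPf kj) mulr0.
Qed.

(* Jordan form by duality: if [N ^+ k] has a nonzero entry at [(a, b)] and
   [N ^+ k.+1 = 0], then the span [V] of the images of the row [a] is a Jordan
   block, and the annihilator of the Krylov space [U] of the column [b] is an
   invariant complement. *)
Lemma nilp_shift_ind (F : fieldType) (P : forall n, 'M[F]_n -> Prop) :
  (forall m n (A : 'M_m) (B : 'M_n), mxsim A B -> P _ A -> P _ B) ->
  (forall m n (A : 'M_m) (B : 'M_n), P _ A -> P _ B -> P _ (block_mx A 0 0 B)) ->
  (forall n, P n (shift_mx F n)) ->
  forall n (N : 'M_n), nilp N -> P n N.
Proof.
move=> Psim Pblock Pshift n; have [m] := ubnP n.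
elim: m n => // m IHm n nm N nN.
have [n0|n_gt0] := posnP n.
  apply: Psim (Pshift n); exists 1%:M, 1%:M; case: (n) n0 N nN => // _ N nN.
  by split; rewrite [LHS]flatmx0 [RHS]flatmx0.
(* The index of nilpotency; it is positive since the size is, and is then renamed [k.+1]. *)
have [k /eqP Nk kmin] :
    exists2 k, N ^+ k == 0 & forall l, N ^+ l == 0 -> (k <= l)%N.
  have ex_k : exists k, N ^+ k == 0 by case: nN => k /eqP; exists k.
  by case: (ex_minnP ex_k) => k; exists k.
case: k Nk kmin => [|k] Nk kmin.
  case: n n_gt0 {nm nN kmin} N Nk => // n _ N /matrixP/(_ 0 0)/eqP.
  by rewrite expr0 !mxE oner_eq0.
have Nl l : (k < l)%N -> N ^+ l = 0.
  by move=> kl; rewrite -(subnKC kl) exprD Nk mul0r.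
have /matrix0Pn[a [b Nab]] : N ^+ k != 0.
  by apply/negP=> /kmin; rewrite ltnn.
pose V : 'M_(k.+1, n) := \matrix_(i, j) (N ^+ i) a j.
pose U : 'M_(n, k.+1) := \matrix_(i, j) (N ^+ (k - j)) i b.
(* The entry (i, j) is that of [N ^+ (i + (k - j))] at (a, b): zero above the diagonal, and the
   nonzero entry of [N ^+ k] on it. *)
have VU_unit : V *m U \in unitmx.
  have VUE i j : (V *m U) i j = (N ^+ (i + (k - j))) a b.
    by rewrite exprD -[in RHS]/(_ *m _) !mxE; apply: eq_bigr => l _; rewrite !mxE.
  rewrite unitmxE -det_tr det_trig.
    rewrite unitfE; apply/prodf_neq0 => i _; rewrite mxE VUE subnKC //.
    by rewrite -ltnS.
  apply/is_trig_mxP => i j ij; rewrite mxE VUE Nl ?mxE //.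
  by have := ltn_ord j; lia.
have VN : V *m N = shift_mx F k.+1 *m V.
  rewrite (@mul_shift_mx _ _ _ (fun i j => (N ^+ i) a j)).
  - apply/matrixP=> i j; rewrite [RHS]mxE exprSr -[_ * N]/(N ^+ i *m N) !mxE.
    by apply: eq_bigr => l _; rewrite mxE.
  - by move=> i j; rewrite mxE.
  - by move=> j; rewrite Nk mxE.
have NU : N *m U = U *m shift_mx F k.+1.
  rewrite (@mulmx_shift _ _ _ (fun i j => (N ^+ (k.+1 - j)) i b)).
  - apply/matrixP=> i j; have jk : (j <= k)%N by rewrite -ltnS.
    rewrite [RHS]mxE (subSn jk) exprS -[N * N ^+ _]/(N *m N ^+ (k - j)) !mxE.
    by apply: eq_bigr => l _; rewrite mxE.
  - by move=> i j; rewrite mxE.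
  - by move=> i; rewrite subn0 Nk mxE.
pose W := row_base (kermx U).
have WU : W *m U = 0 by apply/sub_kermxP; rewrite /W eq_row_base.
have /submxP[N' WN] : (W *m N <= W)%MS.
  rewrite /W eq_row_base; apply/sub_kermxP.
  by rewrite -mulmxA NU mulmxA WU mul0mx.
have rk : \rank U = k.+1.
  apply/eqP; rewrite eqn_leq rank_leq_col /=.
  by apply: leq_trans (mxrankM_maxr V U); rewrite mxrank_unit.
pose C := col_mx V W.
have freeC : row_free C.
  apply: inj_row_free => x; rewrite -[x]hsubmxK mul_row_col => xC.
  have l0 : lsubmx x = 0.
    move/(congr1 (mulmx^~ U)): (xC).
    rewrite mul0mx mulmxDl -(mulmxA _ V) -(mulmxA _ W) WU mulmx0 addr0.
    by move/(canRL (mulmxK VU_unit)); rewrite mul0mx.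
  move: xC; rewrite l0 mul0mx add0r => xW.
  have /row_free_inj freeW := row_base_free (kermx U).
  by rewrite (_ : rsubmx x = 0) ?row_mx0 //; apply: (freeW 1%N); rewrite mul0mx.
have rkC : (k.+1 + \rank (kermx U))%N = n.
  by rewrite mxrank_ker rk subnKC // -rk rank_leq_row.
have fullC : row_full C by rewrite /row_full (eqnP freeC) rkC.
have simC : mxsim (block_mx (shift_mx F k.+1) 0 0 N') N.
  exists C, (pinvmx C); rewrite mulmxVp // mulVpmx //; split=> //.
  by rewrite mul_block_col mul_col_mx VN WN !mul0mx addr0 add0r.
apply: Psim simC _; apply: Pblock => //; apply: IHm.
  by move: nm rkC; lia.
exists k.+1; have /row_free_inj freeW := row_base_free (kermx U).
apply: (freeW (\rank (kermx U))); rewrite mul0mx.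
suff -> : forall l, N' ^+ l *m W = W *m N ^+ l by rewrite Nk mulmx0.
elim=> [|l IHl]; first by rewrite !expr0 mul1mx mulmx1.
rewrite exprSr exprSr -[N' ^+ l * N']/(N' ^+ l *m N') -[N ^+ l * N]/(N ^+ l *m N).
by rewrite -(mulmxA _ N' W) -WN (mulmxA _ W N) IHl -mulmxA.
Qed.

(** * Unipotent Jordan blocks of size other than 2 *)

Definition bidiag (F : fieldType) n (S : nat -> bool) : 'M[F]_n :=
  \matrix_(i, j) ((i == j) || S i && (j == i.+1 :> nat))%:R.

Lemma eq_bidiag (F : fieldType) n (S T : nat -> bool) :
  S =1 T -> bidiag F n S = bidiag F n T.
Proof. by move=> ST; apply/matrixP=> i j; rewrite !mxE ST. Qed.

Lemma bidiag_block (F : fieldType) m n (S : nat -> bool) :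
  (forall i, i.+1 = m -> S i = false) ->
  bidiag F (m + n) S =
  block_mx (bidiag F m S) 0 0 (bidiag F n (fun i => S (m + i)%N)).
Proof.
move=> Sm; apply/matrixP=> i j.
case: (split_ordP i) => k ->; case: (split_ordP j) => l ->.
- by rewrite block_mxEul !mxE (inj_eq (@lshift_inj _ _)).
- rewrite block_mxEur !mxE eq_lrshift /=.
  case: eqP => [E|_]; last by rewrite andbF.
  by rewrite Sm //; have := ltn_ord k; lia.
- rewrite block_mxEdl !mxE eq_rlshift /=.
  by rewrite ltn_eqF ?andbF // (leq_trans (ltn_ord l)) // leqW // leq_addr.
- by rewrite block_mxEdr !mxE (inj_eq (@rshift_inj _ _)) /= -addnS eqn_add2l.
Qed.

(** The last hypothesis is X Y = (1 + K) Y X for X = 1 + N and Y = 1 + M, expanded and with the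
    common terms 1 + N + M cancelled. *)
Lemma unip2_comm_add1 (F : fieldType) n (N M K : 'M[F]_n) :
  N *m N = 0 -> M *m M = 0 ->
  N *m M = M *m N + K + K *m N + K *m M + K *m M *m N ->
  unip2_comm (1%:M + K).
Proof.
move=> N2 M2 NM; exists (1%:M + N), (1%:M + M).
rewrite ![1%:M + _]addrC !addrK; split=> //.
rewrite !(mulmxDl, mulmxDr, mulmx1, mul1mx) NM.
by apply/matrixP=> i j; rewrite !mxE; ring.
Qed.

Ltac delta_calc :=
  rewrite !(mulmxDl, mulmxDr, mulmxBl, mulmxBr, mulmxN, mulNmx,
    mul_delta_mx_cond, mulr0n, mulr1n, mul0mx, mulmx0);
  apply/matrixP=> ? ?; rewrite !mxE; ring.

Ltac ord_cases :=
  apply/matrixP=> -[[|[|[|[|[|?]]]]] ?] -[[|[|[|[|[|?]]]]] ?] //;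
  rewrite !mxE //= ?(addr0, add0r).

Lemma unip2_comm_bidiag3_even (F : fieldType) :
  unip2_comm (bidiag F 3 (fun i => ~~ odd i)).
Proof.
have -> : bidiag F 3 (fun i => ~~ odd i) = 1%:M + delta_mx 0 1 by ord_cases.
by apply: (@unip2_comm_add1 _ _ (delta_mx 0 2) (delta_mx 2 1)); delta_calc.
Qed.

Lemma unip2_comm_bidiag3_odd (F : fieldType) : unip2_comm (bidiag F 3 odd).
Proof.
have -> : bidiag F 3 odd = 1%:M + delta_mx 1 2 by ord_cases.
by apply: (@unip2_comm_add1 _ _ (delta_mx 1 0) (delta_mx 0 2)); delta_calc.
Qed.

Lemma unip2_comm_bidiag4_even (F : fieldType) :
  unip2_comm (bidiag F 4 (fun i => ~~ odd i)).
Proof.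
have -> : bidiag F 4 (fun i => ~~ odd i) = 1%:M + (delta_mx 0 1 + delta_mx 2 3).
  by ord_cases.
apply: (@unip2_comm_add1 _ _ (delta_mx 0 2 - delta_mx 1 3)
  (delta_mx 2 1 - delta_mx 2 3)); delta_calc.
Qed.

(** This is the direct sum of Jordan blocks of sizes 2 and 3, needed for sizes congruent to 2 modulo
    4. *)
Lemma unip2_comm_bidiag5 (F : fieldType) :
  unip2_comm (bidiag F 5 (fun i => i \in [:: 0; 2; 3])).
Proof.
have -> : bidiag F 5 (fun i => i \in [:: 0; 2; 3]%N) =
    1%:M + (delta_mx 0 1 + delta_mx 2 3 + delta_mx 3 4).
  by ord_cases.
apply: (@unip2_comm_add1 _ _ (delta_mx 2 0 + delta_mx 3 4 - delta_mx 3 1)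
  (delta_mx 0 3 - delta_mx 0 1 - delta_mx 1 4 - delta_mx 3 4)); delta_calc.
Qed.

Lemma bidiag_le1 (F : fieldType) n S : (n <= 1)%N -> bidiag F n S = 1%:M.
Proof.
move=> n1; apply/matrixP=> i j; rewrite !mxE.
have /negPf-> : (j != i.+1 :> nat) by have := ltn_ord j; lia.
by rewrite andbF orbF.
Qed.

Lemma unip2_comm_bidiag_even (F : fieldType) j r :
  unip2_comm (bidiag F r (fun i => ~~ odd i)) ->
  unip2_comm (bidiag F (4 * j + r) (fun i => ~~ odd i)).
Proof.
move=> cr; elim: j => [|j IHj]; first by rewrite muln0.
rewrite mulnS -addnA bidiag_block => [|i [->] //].
apply: unip2_comm_block; first exact: unip2_comm_bidiag4_even.
by rewrite (@eq_bidiag _ _ _ (fun i => ~~ odd i)) // => i; rewrite oddD.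
Qed.

Lemma unip2_comm_bidiag_even0 (F : fieldType) j :
  unip2_comm (bidiag F (4 * j) (fun i => ~~ odd i)).
Proof.
rewrite -[(4 * j)%N]addn0; apply: unip2_comm_bidiag_even.
by rewrite bidiag_le1 //; apply: unip2_comm1.
Qed.

Lemma unip2_comm_bidiag_even1 (F : fieldType) j :
  unip2_comm (bidiag F (4 * j + 1) (fun i => ~~ odd i)).
Proof.
apply: unip2_comm_bidiag_even.
by rewrite bidiag_le1 //; apply: unip2_comm1.
Qed.

Lemma unip2_comm_bidiag_odd1 (F : fieldType) n :
  unip2_comm (bidiag F n (fun i => ~~ odd i)) -> unip2_comm (bidiag F (1 + n) odd).
Proof.
move=> cn; rewrite bidiag_block => [|i [->] //].
apply: unip2_comm_block; last by [].
by rewrite bidiag_le1 //; apply: unip2_comm1.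
Qed.

Lemma unip2_comm_bidiag_odd3 (F : fieldType) j :
  unip2_comm (bidiag F (3 + 4 * j) odd).
Proof.
rewrite bidiag_block => [|i [->] //].
apply: unip2_comm_block; first exact: unip2_comm_bidiag3_odd.
rewrite (@eq_bidiag _ _ _ (fun i => ~~ odd i)) => [|i]; last by rewrite ?oddD.
exact: unip2_comm_bidiag_even0.
Qed.

(** The first basis row vector is cyclic: its images under the powers of [M] form a triangular
    matrix whose diagonal entries are products of superdiagonal entries of [M]. *)
Lemma regular_nilpotent_shift (F : fieldType) n (M : 'M[F]_n) :
  (forall i j : 'I_n, (j <= i)%N -> M i j = 0) ->
  (forall i j : 'I_n, j = i.+1 :> nat -> M i j != 0) ->
  mxsim (shift_mx F n) M.
Proof.
case: n M => [|n] M M0 M1.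
  by exists 1%:M, 1%:M; split; rewrite [LHS]flatmx0 [RHS]flatmx0.
have P0 k (j : 'I_n.+1) : (j < k)%N -> (M ^+ k) 0 j = 0.
  elim: k j => // k IHk j jk; rewrite exprSr -[_ * M]/(_ *m M) mxE.
  rewrite big1 // => l _; have [lk|kl] := ltnP l k.
    by rewrite IHk // mul0r.
  by rewrite M0 ?mulr0 // (leq_trans _ kl).
have P1 k (j : 'I_n.+1) : j = k :> nat -> (M ^+ k) 0 j != 0.
  elim: k j => [|k IHk] j jk.
    by rewrite (_ : j = 0) ?mxE ?eqxx ?oner_eq0 //; apply/val_inj.
  have kn : (k < n.+1)%N by rewrite ltnW // -jk.
  rewrite exprSr -[_ * M]/(_ *m M) mxE (bigD1 (Ordinal kn)) //= big1 => [|l lk].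
    by rewrite addr0 mulf_neq0 ?IHk ?M1.
  have [lk'|kl] := ltnP l k; first by rewrite P0 // mul0r.
  rewrite M0 ?mulr0 // jk ltn_neqAle kl andbT.
  by apply: contraNneq lk => E; apply/eqP/val_inj.
pose V : 'M_n.+1 := \matrix_(i, j) (M ^+ i) 0 j.
have uV : V \in unitmx.
  rewrite unitmxE -det_tr det_trig ?unitfE.
    by apply/prodf_neq0=> i _; rewrite !mxE P1.
  by apply/is_trig_mxP=> i j ij; rewrite !mxE P0.
apply/mxsim_sym/(mxsim_unit uV).
rewrite (@mul_shift_mx _ _ _ (fun i j => (M ^+ i) 0 j)).
- apply/matrixP=> i j; rewrite [RHS]mxE exprSr -[_ * M]/(M ^+ i *m M) !mxE.
  by apply: eq_bigr => l _; rewrite mxE.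
- by move=> i j; rewrite mxE.
- by move=> j; rewrite P0.
Qed.

(** The product minus 1 is strictly upper triangular, and its superdiagonal entries are S i + T i =
    1, so it is a regular nilpotent matrix. *)
Lemma bidiagM_sim (F : fieldType) n (S T : nat -> bool) :
  (forall i, i.+1 < n -> S i = ~~ T i)%N ->
  mxsim (bidiag F n S *m bidiag F n T) (1%:M + shift_mx F n).
Proof.
move=> ST; set B := _ *m _.
have BE i j : B i j = bidiag F n T i j + (S i)%:R *
    \sum_(k < n | k == i.+1 :> nat) bidiag F n T k j.
  rewrite mxE (bigID (fun k : 'I_n => k == i)) /= big_pred1_eq mxE eqxx mul1r.
  congr (_ + _); rewrite big_distrr /= big_mkcond /= [RHS]big_mkcond /=.
  apply: eq_bigr => k _; rewrite mxE (eq_sym i).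
  have [->|ki] := eqVneq k i; first by rewrite /= ltn_eqF.
  by case: (_ == _); rewrite ?andbT ?andbF ?mul0r.
have [P [Q [PQ QP MP]]] : mxsim (shift_mx F n) (B - 1%:M).
  apply: regular_nilpotent_shift => i j ij.
    have -> : (B - 1%:M) i j = B i j - (i == j)%:R.
      by rewrite mxE [X in _ + X]mxE [X in _ - X]mxE.
    rewrite BE big1 => [|k /eqP ki]; last first.
      have /negPf ij1 : (i.+1 != j)%N by lia.
      have /negPf ij2 : (j != i.+2 :> nat)%N by lia.
      by rewrite mxE -val_eqE /= ki ij1 ij2 andbF.
    rewrite mulr0 addr0 mxE (@ltn_eqF j) ?ltnS // andbF orbF.
    by rewrite subrr.
  have -> : (B - 1%:M) i j = B i j - (i == j)%:R.
      by rewrite mxE [X in _ + X]mxE [X in _ - X]mxE.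
  rewrite BE.
  have nij : (i == j) = false by rewrite -val_eqE /= ij ltn_eqF.
  rewrite nij subr0 (big_pred1 j) => [|k]; last by rewrite -ij val_eqE.
  rewrite !mxE nij eqxx ij eqxx andbT /= ST -?ij // mulr1.
  by case: (T i); rewrite ?add0r ?addr0 oner_eq0.
apply: mxsim_sym; exists P, Q; split=> //.
by rewrite mulmxDl MP mul1mx mulmxBr mulmx1 addrC subrK.
Qed.

(** The superdiagonal is split into even and odd positions, each side being cut into pieces of sizes
    1, 3 and 4 according to the size modulo 4. *)
Lemma prod_comm_shift (F : fieldType) n :
  n <> 2%N -> prod_comm 2 (1%:M + shift_mx F n).
Proof.
move=> n2.
suff [S [T [cS cT ST]]] : exists S T, [/\ unip2_comm (bidiag F n S),
    unip2_comm (bidiag F n T) & forall i, (i.+1 < n)%N -> S i = ~~ T i].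
  apply: prod_comm_sim (bidiagM_sim F ST) _.
  exact: prod_commM (prod_comm_of_comm cS) (prod_comm_of_comm cT).
rewrite (divn_eq n 4) (mulnC _ 4) in n2 *.
have : (n %% 4 < 4)%N by rewrite ltn_mod.
move: (n %/ 4)%N (n %% 4)%N n2 => j [|[|[|[|//]]]] n2 _.
- exists (fun i => ~~ odd i), odd; split=> //.
    by rewrite addn0; apply: unip2_comm_bidiag_even0.
  case: j {n2} => [|j]; first by rewrite bidiag_le1 //; apply: unip2_comm1.
  rewrite (_ : (4 * j.+1 + 0 = 1 + (4 * j + 3))%N); last by lia.
  apply/unip2_comm_bidiag_odd1/unip2_comm_bidiag_even.
  exact: unip2_comm_bidiag3_even.
- exists (fun i => ~~ odd i), odd; split=> //.
    exact: unip2_comm_bidiag_even1.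
  by rewrite addnC; apply/unip2_comm_bidiag_odd1/unip2_comm_bidiag_even0.
(* Here the even positions give an odd number of 2 x 2 blocks and no identity block to go with the
   last one. The positions below 6 are therefore redistributed: one side starts with blocks of sizes
   1, 2, 3, the other with 2, 2, 1, and 2 x 2 blocks follow. *)
- case: j n2 => [|j] // _.
  exists (fun i => if (i < 6)%N then i \in [:: 1; 3; 4] else ~~ odd i),
    (fun i => if (i < 6)%N then i \in [:: 0; 2; 5] else odd i); split.
  + rewrite (_ : (4 * j.+1 + 2 = 1 + (5 + 4 * j))%N); last by lia.
    rewrite bidiag_block => [|i [->] //].
    apply: unip2_comm_block; first by rewrite bidiag_le1 //; apply: unip2_comm1.
    rewrite bidiag_block => [|i [->] //]; apply: unip2_comm_block.
      rewrite (_ : bidiag _ _ _ = bidiag F 5 (fun i => i \in [:: 0; 2; 3]%N)).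
        exact: unip2_comm_bidiag5.
      by apply/matrixP=> -[[|[|[|[|[|?]]]]] ?] l; rewrite !mxE.
    rewrite (@eq_bidiag _ _ _ (fun i => ~~ odd i)) => [|i]; last first.
      by rewrite !oddD /= negbK.
    exact: unip2_comm_bidiag_even0.
  + rewrite (_ : (4 * j.+1 + 2 = 4 + (1 + (4 * j + 1)))%N); last by lia.
    rewrite bidiag_block => [|i [->] //]; apply: unip2_comm_block.
      rewrite (_ : bidiag _ _ _ = bidiag F 4 (fun i => ~~ odd i)).
        exact: unip2_comm_bidiag4_even.
      by apply/matrixP=> -[[|[|[|[|?]]]] ?] l; rewrite !mxE.
    rewrite (@eq_bidiag _ _ _ odd) => [|[|[|i]]]; rewrite ?oddD //.
    exact/unip2_comm_bidiag_odd1/unip2_comm_bidiag_even1.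
  + by move=> [|[|[|[|[|[|i]]]]]].
- exists (fun i => ~~ odd i), odd; split=> //.
    exact/unip2_comm_bidiag_even/unip2_comm_bidiag3_even.
  by rewrite addnC; apply: unip2_comm_bidiag_odd3.
Qed.

(** * Commutators in size 2, and all unipotent matrices *)

Definition mx2 (F : fieldType) (a b c d : F) : 'M[F]_2 :=
  \matrix_(i, j) if i == 0 then if j == 0 then a else b
                 else if j == 0 then c else d.

Lemma mx2P (F : fieldType) (A B : 'M[F]_2) :
  A 0 0 = B 0 0 -> A 0 1 = B 0 1 -> A 1 0 = B 1 0 -> A 1 1 = B 1 1 -> A = B.
Proof.
have ord2 (i : 'I_2) : i = 0 \/ i = 1.
  by case: i => [[|[|i]] li]; [left|right|]; try exact/val_inj.
move=> e00 e01 e10 e11; apply/matrixP=> i j.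
by case: (ord2 i) => ->; case: (ord2 j) => ->.
Qed.

Lemma mul_mx2 (F : fieldType) (a b c d a' b' c' d' : F) :
  mx2 a b c d *m mx2 a' b' c' d' =
  mx2 (a * a' + b * c') (a * b' + b * d') (c * a' + d * c') (c * b' + d * d').
Proof. by apply: mx2P; rewrite !mxE !big_ord_recl big_ord0 !mxE /= addr0. Qed.

Lemma mx2_1 (F : fieldType) : 1%:M = mx2 1 0 0 1 :> 'M[F]_2.
Proof. by apply: mx2P; rewrite !mxE. Qed.

Lemma sub_mx2 (F : fieldType) (a b c d a' b' c' d' : F) :
  mx2 a b c d - mx2 a' b' c' d' = mx2 (a - a') (b - b') (c - c') (d - d').
Proof. by apply: mx2P; rewrite !mxE. Qed.

Lemma mx2_0 (F : fieldType) : 0 = mx2 0 0 0 0 :> 'M[F]_2.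
Proof. by apply: mx2P; rewrite !mxE. Qed.

Lemma mx2_sim_companion (F : fieldType) (a b c d : F) :
  b != 0 -> a * d - b * c = 1 ->
  mxsim (mx2 a b c d) (mx2 0 1 (-1) (a + d)).
Proof.
move=> b0 det1.
exists (mx2 1 0 (- a / b) b^-1), (mx2 1 0 a b); split.
- by rewrite mul_mx2 mx2_1; congr mx2; field.
- by rewrite mul_mx2 mx2_1; congr mx2; field.
- rewrite !mul_mx2; congr mx2; try (by field).
  + have -> : c = (a * d - 1) / b by apply: (mulIf b0); rewrite mulfVK // -det1; ring.
    by field.
Qed.

(* The model commutator is that of [1, 1; 0, 1] and [1, 0; t, 1]. *)
Lemma unip2_comm_mx2 (F : fieldType) (a b c d t : F) :
  b != 0 -> a * d - b * c = 1 -> t != 0 -> a + d = 2%:R + t ^+ 2 ->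
  unip2_comm (mx2 a b c d).
Proof.
move=> b0 det1 t0 tr.
pose C := mx2 (1 + t + t ^+ 2) (- t) (t ^+ 2) (1 - t).
apply: (@unip2_comm_sim _ _ _ C).
  apply: mxsim_trans (mxsim_sym (mx2_sim_companion b0 det1)).
  rewrite tr (_ : 2%:R + t ^+ 2 = 1 + t + t ^+ 2 + (1 - t)); last by ring.
  by apply: mx2_sim_companion; rewrite ?oppr_eq0 //; ring.
exists (mx2 1 1 0 1), (mx2 1 0 t 1).
rewrite !mul_mx2 mx2_1 !sub_mx2 !mul_mx2 mx2_0.
by split; congr mx2; ring.
Qed.

(** Among four elements there are a nonzero [x] and a [y] outside 0, x, -x; equal squares would mean
    y = x or y = -x. *)
Lemma distinct_squares (F : fieldType) : card_geq F 4 ->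
  exists s t : F, [/\ s != 0, t != 0 & s ^+ 2 != t ^+ 2].
Proof.
move=> [l [ul sl]].
have [x xl] : exists2 x, x != 0 & x \in l.
  have : has (fun x => x != 0) l.
    apply: contraT => /hasPn l0.
    have : (size l <= size [:: 0%R : F])%N.
      by apply: uniq_leq_size => // x /l0; rewrite negbK inE.
    by rewrite sl.
  by case/hasP=> x xl x0; exists x.
have : has (fun y => y \notin [:: 0; x; - x]) l.
  apply: contraT => /hasPn lx.
  have : (size l <= size [:: 0%R; x; (- x)%R])%N.
    by apply: uniq_leq_size => // y /lx; rewrite negbK.
  by rewrite sl.
case/hasP=> y _; rewrite !inE !negb_or => /and3P[y0 yx ynx].
by exists x, y; split=> //; rewrite eq_sym eqf_sqr negb_or yx.
Qed.

Lemma unip2_comm_mx2_lower (F : fieldType) (a b c d t : F) :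
  c != 0 -> a * d - b * c = 1 -> t != 0 -> a + d = 2%:R + t ^+ 2 ->
  unip2_comm (mx2 a b c d).
Proof.
move=> c0 det1 t0 tr; apply: (@unip2_comm_sim _ _ _ (mx2 d c b a)).
  exists (mx2 0 1 1 0), (mx2 0 1 1 0); rewrite !mul_mx2 mx2_1.
  by split; congr mx2; ring.
apply: unip2_comm_mx2 c0 _ t0 _; first by rewrite -det1; ring.
by rewrite addrC.
Qed.

Lemma prod_comm_shift2 (F : fieldType) :
  card_geq F 4 -> prod_comm 2 (1%:M + shift_mx F 2).
Proof.
move=> /distinct_squares[s [t [s0 t0 st]]].
have [c c0 cE] : exists2 c, c != 0 & c = s ^+ 2 - t ^+ 2.
  by exists (s ^+ 2 - t ^+ 2); rewrite ?subr_eq0.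
(* The first factor has determinant 1 and trace 2 + s^2; its lower left entry [c] is such that
   multiplying its inverse by the Jordan block lowers the trace by [c], to 2 + t^2. *)
have -> : 1%:M + shift_mx F 2 =
    mx2 1 (s ^+ 2 / c) c (1 + s ^+ 2) *m
    mx2 (1 + s ^+ 2) (1 + s ^+ 2 - s ^+ 2 / c) (- c) (1 - c).
  by rewrite mul_mx2; apply: mx2P; rewrite !mxE /=; field.
apply: (@prod_commM _ 1 1); apply: prod_comm_of_comm.
  apply: (unip2_comm_mx2_lower c0 _ s0); last by ring.
  by field.
apply: (unip2_comm_mx2_lower _ _ t0); first by rewrite oppr_eq0.
  by field.
by rewrite cE; ring.
Qed.

Lemma prod_comm_unipotent (F : fieldType) n (A : 'M[F]_n) :
  card_geq F 4 -> nilp (A - 1%:M) -> prod_comm 2 A.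
Proof.
move=> F4 nA; rewrite -[A](subrK 1%:M) addrC.
apply: (@nilp_shift_ind F (fun n N => prod_comm 2 (1%:M + N))) nA.
- move=> k l B C [P [Q [PQ QP BP]]]; apply: prod_comm_sim; exists P, Q.
  by split=> //; rewrite mulmxDl mulmxDr mul1mx mulmx1 BP.
- move=> k l B C kB kC; rewrite scalar_mx_block add_block_mx !addr0.
  exact: prod_comm_block.
- move=> k; have [->|/eqP] := eqVneq k 2%N; first exact: prod_comm_shift2.
  exact: prod_comm_shift.
Qed.

(** * Cyclic matrices of determinant 1 as products of three commutators *)

(** With u = e_max, the transvection 1 + u c is the commutator of 1 + u g and 1 + v c as soon as c
    u, c v and g u vanish and g v = 1. Size at least 3 leaves room for [v] and [g] away from the
    last coordinate. *)
Lemma unip2_comm_transvection (F : fieldType) n (c : 'rV[F]_n.+3) :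
  c 0 ord_max = 0 -> unip2_comm (1%:M + delta_mx ord_max 0 *m c).
Proof.
move=> c0; set u := delta_mx _ _.
have cu : c *m u = 0.
  by apply/matrixP=> i j; rewrite !ord1 -colE !mxE.
have [v [g [cv gu gv]]] : exists (v : 'cV_n.+3) (g : 'rV_n.+3),
    [/\ c *m v = 0, g *m u = 0 & g *m v = 1%:M].
  have [c00|c00] := eqVneq (c 0 0) 0.
    exists (delta_mx 0 0), (delta_mx 0 0); rewrite !mul_delta_mx_cond /= mulr0n.
    split=> //; first by apply/matrixP=> i j; rewrite !ord1 -colE !mxE.
    by apply/matrixP=> i j; rewrite !ord1 !mxE.
  exists (delta_mx 1 0 - (c 0 1 / c 0 0) *: delta_mx 0 0), (delta_mx 0 1).
  rewrite mulmxBr -!scalemxAr !mul_delta_mx_cond -!colE /= mulr0n; split=> //.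
    by apply/matrixP=> i j; rewrite !ord1 !mxE; field.
  rewrite mulmxBr -scalemxAr !mul_delta_mx_cond /= mulr0n scaler0 subr0.
  by apply/matrixP=> i j; rewrite !ord1 !mxE.
apply: (@unip2_comm_add1 _ _ (u *m g) (v *m c)).
- by rewrite mulmxA -(mulmxA u g) gu mulmx0 mul0mx.
- by rewrite mulmxA -(mulmxA v c) cv mulmx0 mul0mx.
- rewrite !mulmxA -(mulmxA u g) gv mulmx1 -!(mulmxA _ c) cu cv.
  by rewrite !(mulmx0, mul0mx) add0r !addr0.
Qed.

Lemma det_add1_shift (F : fieldType) n : \det (1%:M + shift_mx F n) = 1.
Proof.
rewrite -det_tr det_trig.
  by apply: big1 => i _; rewrite !mxE eqxx ltn_eqF // addr0.
apply/is_trig_mxP=> i j ij; rewrite !mxE -val_eqE /=.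
by rewrite (gtn_eqF ij) ltn_eqF ?addr0 // ltnS ltnW.
Qed.

(* In a Krylov basis [B - 1] is the shift with an arbitrary last row, so [B] is
   a transvection times [1 + shift]. *)
Lemma prod_comm_cyclic (F : fieldType) n (N : 'M[F]_n.+3) (v : 'rV_n.+3) :
  card_geq F 4 -> \det (1%:M + N) = 1 ->
  \matrix_(i, j) (v *m N ^+ i) 0 j \in unitmx -> prod_comm 3 (1%:M + N).
Proof.
move=> F4 detB; set K := \matrix_(_, _) _ => uK.
pose L : 'M_n.+3 := 1%:M + shift_mx F n.+3.
have detL : \det L = 1 := det_add1_shift F n.+3.
have uL : L \in unitmx by rewrite unitmxE detL unitr1.
pose c := row ord_max (K *m N) *m invmx K.
(* [c] expresses the image of the last Krylov row in the Krylov basis; [c'] compensates for the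
   factor [L] to the right of the transvection. *)
pose c' := c *m invmx L.
have KN : K *m N = (shift_mx F n.+3 + delta_mx ord_max 0 *m c) *m K.
  rewrite mulmxDl -mulmxA mulmxKV //.
  pose f i (j : 'I_n.+3) := if (i < n.+3)%N then (v *m N ^+ i) 0 j else 0.
  rewrite (@mul_shift_mx _ _ _ f) => [|i j|j]; last 2 first.
  - by rewrite mxE /f ltn_ord.
  - by rewrite /f ltnn.
  have KNE (i j : 'I_n.+3) : (K *m N) i j = (v *m N ^+ i.+1) 0 j.
    rewrite exprSr -[_ * N]/(_ *m N) mulmxA !mxE.
    by apply: eq_bigr => k _; rewrite mxE.
  have rE j : row ord_max (K *m N) 0 j = (v *m N ^+ n.+3) 0 j by rewrite mxE KNE.
  apply/matrixP=> i j; rewrite KNE; move: (row _ _) rE => r rE.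
  rewrite [RHS]mxE [X in _ = X + _]mxE [X in _ = _ + X]mxE big_ord1 rE.
  rewrite [delta_mx _ _ _ _]mxE eqxx andbT /f.
  have [->|im] := eqVneq i ord_max; first by rewrite ltnn mul1r add0r.
  rewrite mul0r addr0 ifT // ltn_neqAle ltn_ord andbT.
  by apply: contraNneq im => -[E]; apply/eqP/val_inj.
have TL : (1%:M + delta_mx ord_max 0 *m c') *m L =
    1%:M + (shift_mx F n.+3 + delta_mx ord_max 0 *m c).
  by rewrite mulmxDl mul1mx -mulmxA mulmxKV // addrA.
have simB : mxsim ((1%:M + delta_mx ord_max 0 *m c') *m L) (1%:M + N).
  apply/mxsim_sym/(mxsim_unit uK).
  by rewrite TL mulmxDr mulmxDl mulmx1 mul1mx KN.
(* The determinant of the first factor is 1 plus this entry, and it equals 1 because [L] and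
   [1%:M + N] have determinant 1. *)
have c'0 : c' 0 ord_max = 0.
  have : \det (1%:M + delta_mx ord_max 0 *m c') = 1.
    by have := det_mxsim simB; rewrite det_mulmx detL detB mulr1.
  rewrite det_trig.
    rewrite (bigD1 ord_max) //= big1 => [|i /negPf im].
      rewrite mulr1 !mxE big_ord1 !mxE !eqxx mul1r => /(canRL (addKr _)).
      by rewrite addNr.
    by rewrite !mxE big_ord1 !mxE im eqxx mul0r addr0.
  apply/is_trig_mxP=> i j ij; rewrite !mxE big_ord1 !mxE -val_eqE /=.
  rewrite ltn_eqF // (_ : (i == ord_max) = false) ?mul0r ?addr0 //.
  by apply/negbTE; rewrite -val_eqE /=; have := ltn_ord j; lia.
apply: prod_comm_sim simB _; apply: (@prod_commM _ 1 2).
  exact/prod_comm_of_comm/unip2_comm_transvection.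
exact: prod_comm_shift.
Qed.

(** * Scalar matrices of determinant 1 *)

Lemma det_unip2_comm (F : fieldType) n (C : 'M[F]_n) : unip2_comm C -> \det C = 1.
Proof.
move=> [X [Y [/unitmx_sqr_sub1 uX /unitmx_sqr_sub1 uY]]] /(congr1 determinant).
rewrite !det_mulmx -mulrA [\det Y * _]mulrC -[LHS]mul1r => /mulIr -> //.
by rewrite unitrM -!unitmxE uX.
Qed.

(* As [q] has degree [n.+1], the last clause makes [N] cyclic. *)
Definition cyclic_over_comm (F : fieldType) (x : F) n (q : {poly F}) : Prop :=
  exists N C : 'M[F]_n.+1,
    [/\ unip2_comm C, (1%:M + N) *m C = x%:M, size q = n.+2
      & exists v : 'rV_n.+1, forall p, v *m horner_mx N p = 0 -> q %| p].

(** A linear relation between the Krylov rows of [v] is a polynomial of size smaller than that of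
    [q] which kills [v]; being divisible by [q], it is 0. Hence 1 + N takes three commutators and
    [C] the fourth. *)
Lemma prod_comm_scalar_cyclic (F : fieldType) (x : F) n (q : {poly F}) :
  card_geq F 4 -> x ^+ n.+3 = 1 -> cyclic_over_comm x n.+2 q ->
  prod_comm 4 (x%:M : 'M_n.+3).
Proof.
move=> F4 xn [N [C [cC NC sq [v qv]]]].
have detN : \det (1%:M + N) = 1.
  move/(congr1 determinant): NC.
  by rewrite det_mulmx (det_unip2_comm cC) det_scalar xn mulr1.
rewrite -NC; apply: (@prod_commM _ 3 1); last exact: prod_comm_of_comm.
apply: (@prod_comm_cyclic _ _ _ v) => //.
rewrite -row_free_unit; apply: inj_row_free => y yK.
have : q %| rVpoly y.
  apply: qv; rewrite horner_rVpoly [_ *m powers_mx _ _]mulmx_sum_row.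
  rewrite linear_sum mulmx_sumr.
  apply: etrans yK; rewrite mulmx_sum_row; apply: eq_bigr => i _.
  rewrite linearZ /= -scalemxAr [row i (powers_mx _ _)]rowK mxvecK; congr (_ *: _).
  by apply/rowP=> j; rewrite !mxE.
have [y0 _|y0] := eqVneq (rVpoly y) 0; last first.
  by rewrite gtNdvdp // sq ltnS size_poly.
by rewrite -[y]rVpolyK y0 linear0.
Qed.

Lemma horner_mx_block (F : fieldType) m n (A : 'M[F]_m.+1) (B : 'M[F]_n.+1) p :
  horner_mx (block_mx A 0 0 B : 'M[F]_((m + n.+1).+1)) p =
  block_mx (horner_mx A p) 0 0 (horner_mx B p).
Proof.
pose M := 'M[F]_((m + n.+1).+1).
have mulE (C : 'M[F]_m.+1) (D : 'M[F]_n.+1) :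
    (block_mx C 0 0 D : M) * (block_mx A 0 0 B : M) = block_mx (C * A) 0 0 (D * B).
  rewrite -[LHS]/(block_mx C 0 0 D *m block_mx A 0 0 B) mulmx_block.
  by rewrite !(mulmx0, mul0mx, addr0, add0r).
have scE (c : F) : (c%:M : M) = block_mx (c%:M : 'M_m.+1) 0 0 (c%:M : 'M_n.+1).
  exact: (@scalar_mx_block _ m.+1 n.+1).
have addE (C C' : 'M[F]_m.+1) (D D' : 'M[F]_n.+1) :
    (block_mx C 0 0 D : M) + block_mx C' 0 0 D' = block_mx (C + C') 0 0 (D + D').
  rewrite -[LHS]/(block_mx C 0 0 D + block_mx C' 0 0 D') add_block_mx.
  by rewrite !addr0.
elim/poly_ind: p => [|p c IHp]; first by rewrite !rmorph0 block_mx0.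
by rewrite !rmorphD !rmorphM /= !horner_mx_X !horner_mx_C IHp mulE scE addE.
Qed.

(** A polynomial killing the pair (v, v') is divisible by both [q] and [q'], hence by their product
    when they are coprime. *)
Lemma cyclic_over_comm_block (F : fieldType) (x : F) m n (q q' : {poly F}) :
  coprimep q q' -> cyclic_over_comm x m q -> cyclic_over_comm x n q' ->
  cyclic_over_comm x (m + n.+1) (q * q').
Proof.
move=> qq' [N [C [cC NC sq [v qv]]]] [N' [C' [cC' NC' sq' [v' qv']]]].
exists (block_mx N 0 0 N' : 'M_(m.+1 + n.+1)).
exists (block_mx C 0 0 C' : 'M_(m.+1 + n.+1)).
split.
- exact: (@unip2_comm_block _ m.+1 n.+1).
- suff E : (1%:M + block_mx N 0 0 N') *m block_mx C 0 0 C'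
      = x%:M :> 'M_(m.+1 + n.+1).
    exact: E.
  rewrite !scalar_mx_block add_block_mx mulmx_block.
  by rewrite !(mulmx0, mul0mx, addr0, add0r) NC NC'.
- rewrite size_mul ?sq ?sq' -?size_poly_gt0 ?sq ?sq' //=; lia.
- exists (row_mx v v' : 'rV_(m.+1 + n.+1)) => p.
  rewrite horner_mx_block => vp.
  have : row_mx v v' *m block_mx (horner_mx N p) 0 0 (horner_mx N' p) = 0 by [].
  rewrite mul_row_block !mulmx0 addr0 add0r -row_mx0.
  by move=> /eq_row_mx[/qv qp /qv' q'p]; rewrite Gauss_dvdp // qp.
Qed.

Lemma cyclic_over_comm1 (F : fieldType) (x : F) :
  cyclic_over_comm x 0 ('X - (x - 1)%:P).
Proof.
exists (x - 1)%:M, 1%:M; split.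
- exact: unip2_comm1.
- by rewrite mulmx1 -raddfD /= addrC subrK.
- by rewrite size_XsubC.
- exists 1%:M => p; rewrite mul1mx.
  rewrite (_ : horner_mx _ p = p.[x - 1]%:M); last first.
    elim/poly_ind: p => [|p c IHp]; first by rewrite rmorph0 horner0 raddf0.
    rewrite rmorphD rmorphM /= horner_mx_X horner_mx_C IHp hornerMXaddC.
    by rewrite -[_ * _]/(_ *m _) -scalar_mxM -raddfD.
  move=> /matrixP/(_ 0 0); rewrite !mxE /= mulr1n => p0.
  by rewrite dvdp_XsubCl rootE p0.
Qed.

Lemma scalar_mx2 (F : fieldType) (c : F) : c%:M = mx2 c 0 0 c :> 'M[F]_2.
Proof. by apply: mx2P; rewrite !mxE ?mulr1n. Qed.

Lemma add_mx2 (F : fieldType) (a b c d a' b' c' d' : F) :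
  mx2 a b c d + mx2 a' b' c' d' = mx2 (a + a') (b + b') (c + c') (d + d').
Proof. by apply: mx2P; rewrite !mxE. Qed.

(* The characteristic polynomial of the 2 x 2 matrix [N] for which
   [x * (1 + N)^-1] has determinant 1 and trace [2 + r ^ 2]. *)
Definition comm_quad (F : fieldType) (x r : F) : {poly F} :=
  ('X + 1) ^+ 2 - (x * (2%:R + r ^+ 2))%:P * ('X + 1) + (x ^+ 2)%:P.

(** [N] is the companion matrix of the quadratic, with cyclic vector (1, 0), and the commutator is x
    (1 + N)^-1, where 1 + N has determinant x^2. *)
Lemma cyclic_over_comm2 (F : fieldType) (x r : F) :
  x != 0 -> r != 0 -> cyclic_over_comm x 1 (comm_quad x r).
Proof.
move=> x0 r0; pose a := x * (2%:R + r ^+ 2) - 1 - x ^+ 2.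
pose b := x * (2%:R + r ^+ 2) - 2%:R.
have qE : comm_quad x r = 'X^2 + ((- b)%:P * 'X + (- a)%:P).
  by rewrite /comm_quad /a /b; ring.
pose N := mx2 0 1 a b.
have Nq : horner_mx N (comm_quad x r) = 0.
  rewrite qE expr2 !rmorphD !rmorphM /= horner_mx_X !horner_mx_C.
  rewrite -[N * N]/(N *m N) -[_ * N]/(_ *m N) !scalar_mx2 !mul_mx2 !add_mx2.
  by rewrite mx2_0; congr mx2; ring.
have sq : size (comm_quad x r) = 3%N.
  rewrite qE size_polyDl size_polyXn // size_MXaddC.
  by case: ifP => // _; rewrite ltnS size_polyC; case: (_ != 0).
exists N, (mx2 ((x * (2%:R + r ^+ 2) - 1) / x) (- x^-1) (- a / x) x^-1); split.
- apply: (@unip2_comm_mx2 _ _ _ _ _ r) => //.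
  + by rewrite oppr_eq0 invr_eq0.
  + by rewrite /a; field.
  + by field.
- rewrite !scalar_mx2 add_mx2 mul_mx2.
  by congr mx2; rewrite /a /b; field.
- exact: sq.
- exists (delta_mx 0 0) => p.
  have q0 : comm_quad x r != 0 by rewrite -size_poly_gt0 sq.
  rewrite {1}(divp_eq p (comm_quad x r)) rmorphD rmorphM /= Nq mulr0 add0r.
  have := ltn_modpN0 p q0; rewrite sq ltnS /dvdp; move: (p %% _) => s s2.
  have sE : s = s`_1 *: 'X + (s`_0)%:P.
    apply/polyP=> -[|[|i]]; rewrite !coefE ?mulr0 ?mulr1 ?add0r ?addr0 //.
    by rewrite nth_default // (leq_trans s2).
  rewrite sE rmorphD /= horner_mxZ horner_mx_X horner_mx_C mulmxDr -scalemxAr.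
  rewrite mul_mx_scalar -rowE => /rowP E; have := E 0; have := E 1.
  rewrite !mxE /= !mulr0 !mulr1 add0r addr0 => -> ->.
  by rewrite scale0r add0r.
Qed.

(** Put Y = X + 1. The difference of the two quadratics is a nonzero constant times Y, and each
    quadratic is x^2 modulo Y; the Bezout coefficients follow. *)
Lemma coprime_comm_quad (F : fieldType) (x r s : F) :
  x != 0 -> r ^+ 2 != s ^+ 2 -> coprimep (comm_quad x r) (comm_quad x s).
Proof.
move=> x0; rewrite -subr_eq0 => rs0; apply/Bezout_coprimepP.
pose a := (x * (s ^+ 2 - r ^+ 2))^-1; pose b := x ^- 2.
pose w : {poly F} := ('X + 1 - (x * (2%:R + r ^+ 2))%:P) * a%:P.
exists (b%:P * (1 - w), b%:P * w) => /=.
have aE : a%:P * (x * (s ^+ 2 - r ^+ 2))%:P = 1.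
  by rewrite -polyCM mulVf // mulf_neq0 // -opprB oppr_eq0.
have bE : b%:P * (x ^+ 2)%:P = 1 by rewrite -polyCM mulVf // expf_neq0.
rewrite (_ : _ + _ = 1) ?eqpxx // -[RHS]bE /comm_quad /w.
rewrite -mulrA -mulrA -mulrDr; congr (_ * _).
transitivity ((x ^+ 2)%:P + ('X + 1 - (x * (2%:R + r ^+ 2))%:P) * ('X + 1) *
  (1 - a%:P * (x * (s ^+ 2 - r ^+ 2))%:P)); last first.
  by rewrite aE subrr mulr0 addr0.
ring.
Qed.

(** The value of the quadratic at x - 1 is -(x r)^2. *)
Lemma coprime_comm_quad_XsubC (F : fieldType) (x r : F) :
  x != 0 -> r != 0 -> coprimep ('X - (x - 1)%:P) (comm_quad x r).
Proof.
move=> x0 r0; rewrite coprimep_sym coprimep_XsubC rootE /comm_quad.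
rewrite !hornerE subrK.
rewrite (_ : _ + _ = - (x * r) ^+ 2); last by ring.
by rewrite oppr_eq0 expf_neq0 // mulf_neq0.
Qed.

Lemma prim_root_neq0 (F : fieldType) (x : F) d : d.-primitive_root x -> x != 0.
Proof.
move=> prim_x; apply: contra_eq_neq (prim_expr_order prim_x) => ->.
by rewrite expr0n gtn_eqF ?(prim_order_gt0 prim_x) // eq_sym oner_eq0.
Qed.

(** The parameters are r = x^i for i at most m; their squares x^(2i) are distinct because 2i < d. *)
Lemma cyclic_over_comm_even (F : fieldType) (x : F) d m :
  d.-primitive_root x -> (m.*2.+1 < d)%N ->
  cyclic_over_comm x m.*2.+1 (\prod_(i < m.+1) comm_quad x (x ^+ i)).
Proof.
move=> prim_x; have x0 := prim_root_neq0 prim_x.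
elim: m => [|m IHm] md.
  by rewrite big_ord1; apply: cyclic_over_comm2; rewrite ?expf_neq0.
rewrite big_ord_recr /= mulrC; apply: (@cyclic_over_comm_block _ _ 1%N m.*2.+1).
- apply: (big_ind (fun p => coprimep _ p)) => [|p q cp cq|i _].
  + exact: coprimep1.
  + by rewrite coprimepMr cp.
  + apply: coprime_comm_quad; rewrite // -!exprM (eq_prim_root_expr prim_x).
    by have := ltn_ord i => im; rewrite !modn_small; lia.
- by apply: cyclic_over_comm2; rewrite ?expf_neq0.
- by apply: IHm; lia.
Qed.

Lemma prod_comm_prim_root (F : fieldType) (x : F) d :
  card_geq F 4 -> d.-primitive_root x -> prod_comm 4 (x%:M : 'M_d).
Proof.
move=> F4 prim_x; have x0 := prim_root_neq0 prim_x.
have xd := prim_expr_order prim_x.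
case: d prim_x xd => [|[|[|d]]] prim_x xd.
- by have := prim_order_gt0 prim_x.
- by move: xd; rewrite expr1 => ->; apply: prod_comm1.
- have x1 : x != 1.
    by rewrite -(expr0 x) -[X in X != _]expr1 (eq_prim_root_expr prim_x).
  have xE : x = -1.
    by move/eqP: xd; rewrite sqrf_eq1 (negPf x1) => /eqP.
  have two0 : 2%:R != 0 :> F.
    by move: x1; rewrite xE eq_sym -subr_eq0 opprK.
  (* The product is the matrix with rows (1, 1) and (-2, -1), of trace 0 and determinant 1, so its
     square is -1. *)
  pose S : 'M[F]_2 := mx2 1 2%:R 2%:R 5%:R *m mx2 9%:R 7%:R (- 4%:R) (- 3%:R).
  have -> : x%:M = S *m S.
    by rewrite /S xE scalar_mx2 !mul_mx2; congr mx2; ring.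
  suff c2 : prod_comm 2 S by apply: (@prod_commM _ 2 2).
  apply: (@prod_commM _ 1 1); apply: prod_comm_of_comm.
    by apply: (@unip2_comm_mx2 _ _ _ _ _ 2%:R) => //; ring.
  apply: (@unip2_comm_mx2_lower _ _ _ _ _ 2%:R) => //; try ring.
  rewrite oppr_eq0 (_ : 4%:R = 2%:R * 2%:R); last by ring.
  by rewrite mulf_neq0.
suff [q cq] : exists q, cyclic_over_comm x d.+2 q.
  exact: prod_comm_scalar_cyclic cq.
(* The size is [d.+3]: if it is even, 2 x 2 blocks fill it; if it is odd, one 1 x 1 block is added,
   on which the commutator is 1. *)
have := odd_double_half d; case: (odd d) => /= dE.
- have md : (d./2.+1.*2.+1 < d.+3)%N by lia.
  have := cyclic_over_comm_even prim_x md.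
  by rewrite doubleS (_ : (d./2.*2.+3 = d.+2)%N); [eexists; eassumption | lia].
- have md : (d./2.*2.+1 < d.+3)%N by lia.
  have cq := cyclic_over_comm_even prim_x md.
  rewrite (_ : d.+2 = 0 + (d./2.*2.+1).+1)%N; last by lia.
  eexists.
  apply: (@cyclic_over_comm_block _ _ 0%N d./2.*2.+1) (cyclic_over_comm1 x) cq.
  apply: (big_ind (fun p => coprimep _ p)) => [|p q cp cq|i _].
  + exact: coprimep1.
  + by rewrite coprimepMr cp.
  + by apply: coprime_comm_quad_XsubC; rewrite ?expf_neq0.
Qed.

Lemma prod_comm_scalar (F : fieldType) (x : F) n :
  card_geq F 4 -> x ^+ n = 1 -> prod_comm 4 (x%:M : 'M_n).
Proof.
move=> F4; case: (posnP n) => [-> _|n_gt0].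
  by rewrite [_%:M]flatmx0 -[0](flatmx0 1%:M); apply: prod_comm1.
move=> /(prim_order_exists n_gt0)[d prim_x /dvdnP[k ->]].
elim: k => [|k IHk].
  by rewrite [_%:M]flatmx0 -[0](flatmx0 1%:M); apply: prod_comm1.
rewrite mulSn scalar_mx_block; apply: prod_comm_block => //.
exact: prod_comm_prim_root.
Qed.

(** * Assembly of the scalar and nonscalar cases *)

Lemma prod_comm_SL (F : fieldType) n (A : 'M[F]_n) :
  card_geq F 4 -> \det A = 1 -> prod_comm 4 A.
Proof.
move=> F4 detA; have [/is_scalar_mxP[x AE]|nsA] := boolP (is_scalar_mx A).
  by rewrite AE; apply: prod_comm_scalar; rewrite // -det_scalar -AE.
have [B [C [nB nC ->]]] := nonscalar_unip_prod nsA detA.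
by apply: (@prod_commM _ 2 2); apply: prod_comm_unipotent.
Qed.

Theorem theorem4p8 (F : fieldType) (n : nat) (hn : (2 < n)%N)
    (hF : card_geq F 4) (A : 'M[F]_n) (hA : \det A = 1) :
  exists s : seq 'M[F]_n,
    [/\ (size s <= 4)%N,
        forall B : 'M[F]_n, B \in s -> U2_commutator B
      & A = \big[mulmx/1%:M]_(B <- s) B].
Proof.
have : prod_comm 4 A by apply: prod_comm_SL.
elim: 4%N A {hA} => [|k IHk] A /=.
  by move=> ->; exists [::]; rewrite big_nil.
move=> [B [C [cB /IHk[s [sk sU CE]] AE]]]; exists (B :: s); split=> //.
- move=> D; rewrite inE => /orP[/eqP->|]; last exact: sU.
  by apply: U2_commutator_of_unip2 cB; apply: ltnW.
- by rewrite big_cons -CE.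
Qed.
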